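(* Let $0<p<1$, let $H_0,H_1$ be probability distributions on $\mathbb{R}$ with expected values $\mu(H_0)=0$, $\mu(H_1)=1$ and finite variances $\sigma_0^2=\sigma^2(H_0)$, $\sigma_1^2=\sigma^2(H_1)$, and let $X_1,X_2,\ldots$ be obtained from $H_0,H_1$ by exponential sampling with selection variables $B_0,B_1,\ldots$, as defined in the context. For $n\ge 1$ let ${\bf B}_n=(B_{n-1},\ldots,B_0)$, $S_n=\sum_{i=1}^{2^n-1}X_i$, $\bar X_n=S_n/(2^n-1)$ and $Y_n=E(\bar X_n\mid{\bf B}_n)$. Then $E\bar X_n=p$ and $$\sigma^2(\bar X_n)=\sigma^2(Y_n)+\frac{p\,\sigma_1^2+(1-p)\,\sigma_0^2}{2^n-1}.$$
   Context: Exponential sampling: Given two parent distributions $H_0,H_1$ and $0<p<1$, let $B_0,B_1,B_2,\ldots$ be independent Bernoulli random variables with $P(B_j=1)=p$, $P(B_j=0)=1-p$. The sample $X_1;X_2,X_3;X_4,\ldots,X_7;\ldots;X_{2^{n-1}},\ldots,X_{2^n-1}$ of size $2^n-1$ consists of $n$ sub-samples, where sub-sample $j$ ($j=1,\ldots,n$) consists of the $2^{j-1}$ variables $X_{2^{j-1}},\ldots,X_{2^j-1}$. Conditional on $(B_0,\ldots,B_{n-1})$, all the $X_i$ are independent, and the variables of sub-sample $j$ are all distributed according to $H_1$ if $B_{j-1}=1$ and according to $H_0$ if $B_{j-1}=0$. $\sigma^2$ denotes variance. *)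

(* Defs.v *)
From HB Require Import structures.
From mathcomp Require Import all_boot all_order all_algebra.
From mathcomp Require Import all_classical all_reals all_analysis.

Set Implicit Arguments.
Unset Strict Implicit.
Unset Printing Implicit Defensive.

Import Order.TTheory GRing.Theory Num.Theory.
Import numFieldNormedType.Exports.

Local Open Scope classical_set_scope.
Local Open Scope ring_scope.

(** The law [mu] is a bare set function so that the definition applies both to
    a probability and to the elementary conditional probabilities below. *)
Definition mutually_independent (d d' : measure_display)
    (T : measurableType d) (T' : measurableType d') (R : realType)
    (mu : set T -> \bar R) (I : set nat) (X : nat -> T -> T') : Prop :=
  forall J : seq nat, uniq J -> [set` J] `<=` I ->
  forall A : nat -> set T', (forall i, measurable (A i)) ->
    (mu (\bigcap_(i in [set` J]) (X i @^-1` A i)) =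
     \prod_(i <- J) mu (X i @^-1` A i))%E.

(** P(A | E), meaningful when [P E] is not zero. *)
Definition cond_prob (d : measure_display) (T : measurableType d)
    (R : realType) (P : probability T R) (E A : set T) : \bar R :=
  (P (A `&` E) * ((fine (P E))^-1)%:E)%E.

(** [Y] is a version of E(X | Z), the conditional expectation of [X] given the
    sigma-algebra generated by [Z]; versions are unique up to [P]-null sets. *)
Definition is_cond_expectation (d d' : measure_display)
    (T : measurableType d) (T' : measurableType d') (R : realType)
    (P : probability T R) (Z : T -> T') (X Y : T -> R) : Prop :=
  [/\ measurable_fun [set: g_sigma_algebra_preimageType Z] Y,
      P.-integrable [set: T] (EFin \o Y) &
      forall A : set T, g_sigma_algebra_preimage Z A ->
        (\int[P]_(w in A) (Y w)%:E = \int[P]_(w in A) (X w)%:E)%E].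

(** (b_{n-1}, ..., b_0) *)
Definition rev_prefix (T : Type) (n : nat) (b : nat -> T) : n.-tuple T :=
  [tuple b (n - i.+1)%N | i < n].

Definition selection_vector (d : measure_display) (T : measurableType d)
    (B : nat -> T -> bool) (n : nat) (w : T) : n.-tuple bool :=
  rev_prefix n (B ^~ w).

(** The variables are X_1, X_2, ...; [X 0] is unconstrained and never used.
    Only b_0, ..., b_{n-1} matter in the conditioning event {B_n = b}, whose
    probability is positive for 0 < p < 1. *)
Record exponential_sampling (d : measure_display) (T : measurableType d)
    (R : realType) (P : probability T R) (p : R) (H0 H1 : probability R R)
    (B : nat -> {RV P >-> bool}) (X : nat -> {RV P >-> R}) : Prop := {
  selection_independent : mutually_independent P [set: nat] B;
  selection_bernoulli : forall (j : nat) (A : set bool),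
    distribution P (B j) A = bernoulli_prob p A;
  sample_cond_independent : forall (n : nat) (b : nat -> bool),
    mutually_independent
      (cond_prob P (selection_vector B n @^-1` [set rev_prefix n b]))
      [set i | (1 <= i < 2 ^ n)%N] X;
  sample_cond_law : forall (n : nat) (b : nat -> bool) (j i : nat),
    (1 <= j <= n)%N -> (2 ^ j.-1 <= i < 2 ^ j)%N ->
    forall A : set R, measurable A ->
      cond_prob P (selection_vector B n @^-1` [set rev_prefix n b])
        (X i @^-1` A) = (if b j.-1 then H1 else H0) A }.

Definition sample_sum (T : Type) (R : realType) (X : nat -> T -> R) (n : nat)
    (w : T) : R :=
  \sum_(1 <= i < 2 ^ n) X i w.

Definition sample_mean (T : Type) (R : realType) (X : nat -> T -> R) (n : nat)
    (w : T) : R :=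
  sample_sum X n w / (2 ^+ n - 1).

(* Main.v *)
Require Import Defs.
From HB Require Import structures.
From mathcomp Require Import all_boot all_order all_algebra.
From mathcomp Require Import all_classical all_reals all_analysis.
From mathcomp Require Import measurable_realfun.
From mathcomp Require Import ring zify.

Set Implicit Arguments.
Unset Strict Implicit.
Unset Printing Implicit Defensive.

Import Order.TTheory GRing.Theory Num.Theory.
Import numFieldNormedType.Exports.

Local Open Scope classical_set_scope.
Local Open Scope ring_scope.
Local Open Scope ereal_scope.

(** This is the law of total variance for conditioning on the selection vector
    [Z] = (B_(n-1), ..., B_0), which takes finitely many values [t], each with
    positive probability.

    Given [Z = t], the probability [P] becomes an honest probability measure
    [Q t] ([conditional_probability]), under which the sample variables are
    independent, [X i] having law [H1] or [H0] according to the selection bit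
    of its sub-sample. With [N = 2 ^ n - 1] the size of the sample, linearity
    and the additivity of variance over uncorrelated variables
    ([variance_sum_uncorrelated]) show that under [Q t] the sample mean has
    - mean m(t), the proportion of variables drawn from [H1];
    - variance v(t), which is N^-2 times the sum of the variances of the laws
      of the [X i] ([sample_mean_cond_moments]).

    Any version of E(sample mean | Z) is constant on the fibers of [Z], and
    these are not negligible, so that it equals m(Z) at every point
    ([cond_expectation_eq_cond_mean]). Summing over the fibers
    ([total_expectation]), the mean of the sample mean is E m(Z), and its
    variance is E[v(Z) + (m(Z) - p)^2], the second term of which is the
    variance of m(Z). Finally each selection bit is a Bernoulli variable of
    parameter p, so that any average of a function of the bits over the sample
    is explicit ([block_average]): E m(Z) = p, and
    E v(Z) = (p * v1 + (1 - p) * v0) / N for v1 and v0 the variances of [H1]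
    and [H0]. *)

(** * Second moments *)

Section second_moments.
Context d (T : measurableType d) (R : realType).

Lemma Lfun2_integral_sqr (P : probability T R) (f : T -> R) :
  measurable_fun setT f -> \int[P]_w ((f w ^+ 2)%:E) < +oo ->
  f \in Lfun P 2%:E.
Proof.
move=> mf foo; rewrite inE; apply/andP; split; rewrite inE//=.
rewrite /finite_norm unlock; apply: poweR_lty.
rewrite (eq_integral (fun w => (f w ^+ 2)%:E))// => w _ /=.
by rewrite powR_mulrn// real_normK// num_real.
Qed.

Lemma variance_sqr (P : probability T R) (f : T -> R) (m : R) :
  'E_P[f] = m%:E -> 'V_P[f] = \int[P]_w (((f w - m) ^+ 2)%:E).
Proof.
move=> Em; rewrite /variance unlock Em unlock.
by apply: eq_integral => w _ /=; rewrite expr2.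
Qed.

(** The second moment about an arbitrary point [c] is what appears when the
    conditional means differ from the global one. *)
Lemma integral_sqr_shift (P : probability T R) (f : T -> R) (m v c : R) :
  f \in Lfun P 2%:E -> 'E_P[f] = m%:E -> 'V_P[f] = v%:E ->
  \int[P]_w (((f w - c) ^+ 2)%:E) = (v + (m - c) ^+ 2)%:E.
Proof.
move=> f2 Em Vv.
have Pfin : P setT \is a fin_num := fin_num_measure P _ measurableT.
have fc2 : (f \- cst c)%R \in Lfun P 2%:E.
  by rewrite rpredB ?lee1n// => ?; exact: Lfun_cst.
have c1 : cst c \in Lfun P 1 by apply: Lfun_cst.
have f1 : f \in Lfun P 1 by exact: (Lfun_subset12 Pfin).
have := varianceE fc2.
rewrite varianceB_cst_r// Vv expectationB// Em expectation_cst.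
rewrite unlock => /(congr1 (fun x => x + ((m - c) ^+ 2)%:E)).
by rewrite -EFinB -EFin_expe subeK.
Qed.

(** Bienayme's identity: expand the square; the cross terms are covariances. *)
Lemma variance_sum_uncorrelated (P : probability T R) (I : eqType) (s : seq I)
    (X : I -> T -> R) :
  uniq s -> {in s, forall i, X i \in Lfun P 2%:E} ->
  {in s &, forall i j, i != j -> covariance P (X i) (X j) = 0} ->
  'V_P[(\sum_(i <- s) X i)%R] = \sum_(i <- s) 'V_P[X i].
Proof.
elim: s => [|i s IHs]; first by rewrite !big_nil variance_cst.
move=> /= /andP[sNi us] L2 cov0; rewrite !big_cons.
have L2s : {in s, forall j, X j \in Lfun P 2%:E}.
  by move=> j js; apply: L2; rewrite inE js orbT.
have L2i : X i \in Lfun P 2%:E by apply: L2; rewrite inE eqxx.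
have cov_sum (r : seq I) : {subset r <= s} ->
    covariance P (X i) (\sum_(j <- r) X j)%R = 0.
  elim: r => [|j r IHr] rs; first by rewrite big_nil covariance_cst_r.
  have js : j \in s by apply: rs; rewrite inE eqxx.
  have {}rs : {subset r <= s} by move=> k kr; apply: rs; rewrite inE kr orbT.
  rewrite big_cons covarianceDr ?IHr //; last 2 first.
  - exact: L2s.
  - by rewrite big_seq rpred_sum ?lee1n// => ? k kr; rewrite L2s// rs.
  rewrite adde0 cov0 ?inE ?eqxx ?js ?orbT//.
  by apply: contraNneq sNi => ->.
rewrite varianceD//; last by rewrite big_seq rpred_sum ?lee1n.
rewrite cov_sum// mule0 adde0 IHs//.
by move=> j k js ks; apply: cov0; rewrite inE ?js ?ks orbT.
Qed.

(** Independence says that the joint law of [X] and [Y] agrees with the product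
    of their laws on rectangles, hence everywhere; Fubini's theorem then gives
    the factorization of the expectation of the product. Square integrability
    makes that product integrable by Hoelder's inequality. *)
Lemma independent_covariance0 (P : probability T R) (X Y : {mfun T >-> R}) :
  (forall A C, measurable A -> measurable C ->
    P (X @^-1` A `&` Y @^-1` C) = P (X @^-1` A) * P (Y @^-1` C)) ->
  (X : T -> R) \in Lfun P 2%:E -> (Y : T -> R) \in Lfun P 2%:E ->
  covariance P X Y = 0.
Proof.
move=> XY X2 Y2.
have Pfin : P setT \is a fin_num := fin_num_measure P _ measurableT.
have X1 := Lfun_subset12 Pfin X2; have Y1 := Lfun_subset12 Pfin Y2.
have XY1 := Lfun2_mul_Lfun1 X2 Y2.
rewrite covarianceE//.
suff -> : 'E_P[(X : T -> R) * (Y : T -> R)] = 'E_P[X] * 'E_P[Y].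
  by rewrite subee// fin_numM// expectation_fin_num.
pose Z w := (X w, Y w).
have mZ : measurable_fun setT Z by exact/measurable_fun_pair.
pose Z' : {mfun T >-> (R * R)%type} :=
  HB.pack Z (isMeasurableFun.Build _ _ _ _ Z mZ).
pose f (z : R * R) := (z.1 * z.2)%:E.
have mf : measurable_fun setT f.
  by apply/measurable_EFinP/measurable_funM.
pose PX := distribution P X; pose PY := distribution P Y.
have ZE A : measurable A -> (PX \x PY) A = distribution P Z' A.
  apply: product_measure_unique => B C mB mC.
  by rewrite /= /pushforward/= -XY.
have fZ : P.-integrable setT (f \o Z') by exact/Lfun1_integrable.
have intf : (PX \x PY).-integrable setT f.
  have /integrableP[_ foo] := integrable_pushforward mZ mf fZ measurableT.
  apply/integrableP; split => //; apply: le_lt_trans foo.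
  rewrite (eq_measure_integral (distribution P Z'))//.
  by move=> A mA _; exact: ZE.
transitivity (\int[P]_w (f \o Z') w); first by rewrite unlock.
rewrite -(integral_distribution (X := Z') mf fZ).
rewrite (eq_measure_integral (PX \x PY)); last by move=> A mA _; exact/esym/ZE.
rewrite -integral12_prod_meas1//.
have IX : \int[PX]_x x%:E = 'E_P[X].
  rewrite integral_distribution//; last exact/Lfun1_integrable.
  by rewrite unlock.
have IY : \int[PY]_y y%:E = 'E_P[Y].
  rewrite integral_distribution//; last exact/Lfun1_integrable.
  by rewrite unlock.
have iX : PX.-integrable setT (EFin : R -> \bar R).
  apply: integrable_pushforward => //.
  exact/Lfun1_integrable.
have iY : PY.-integrable setT (EFin : R -> \bar R).
  apply: integrable_pushforward => //.
  exact/Lfun1_integrable.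
have Yfin : 'E_P[Y] \is a fin_num by exact: expectation_fin_num.
rewrite (eq_integral (fun x : R => x%:E * 'E_P[Y])); last first.
  by move=> x _; rewrite -IY -integralZl.
by rewrite -(fineK Yfin) integralZr// IX.
Qed.

End second_moments.

(** Change of variables. The second moment about [m] is transferred first: its
    finiteness is what makes [X] integrable, hence allows the transfer of the
    mean. *)
Lemma moments_of_law d (T : measurableType d) (R : realType)
    (P : probability T R) (X : {mfun T >-> R}) (H : probability R R) (m v : R) :
  (forall A, measurable A -> P (X @^-1` A) = H A) ->
  'E_H[(fun x : R => x)] = m%:E -> 'V_H[(fun x : R => x)] = v%:E ->
  [/\ (X : T -> R) \in Lfun P 2%:E, 'E_P[X] = m%:E & 'V_P[X] = v%:E].
Proof.
move=> XH EH VH.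
have transfer f : \int[distribution P X]_x f x = \int[H]_x f x.
  by apply: eq_measure_integral => A mA _; exact: XH.
have Pfin : P setT \is a fin_num := fin_num_measure P _ measurableT.
have sqr : \int[P]_w (((X w - m) ^+ 2)%:E) = v%:E.
  rewrite -VH (variance_sqr EH) -transfer ge0_integral_distribution//.
  - apply/measurable_EFinP; apply: measurable_funX.
    exact: measurable_funB.
  - by move=> x; rewrite lee_fin sqr_ge0.
have c2 : cst m \in Lfun P 2%:E by exact: Lfun_cst.
have X2 : (X : T -> R) \in Lfun P 2%:E.
  rewrite -[X : T -> R](subrK (cst m)) rpredD ?lee1n// => ?.
  apply: Lfun2_integral_sqr; first exact: measurable_funB.
  by rewrite sqr ltry.
have EX : 'E_P[X] = m%:E.
  rewrite -EH !unlock -transfer integral_distribution//.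
  by apply/Lfun1_integrable; exact: (Lfun_subset12 Pfin).
by split=> //; rewrite (variance_sqr EX).
Qed.

(** * Conditioning on an event, and total expectation *)

Section conditioning.
Context d (T : measurableType d) (R : realType) (P : probability T R).

(** As a probability measure, so that the theory of expectation, variance and
    covariance applies to it. Normalization resorts to its second argument,
    here [P], only if [E] is negligible. *)
Definition conditional_probability (E : set T) (mE : measurable E) :
  probability T R := mnormalize (mrestr P mE) P.

Variables (E : set T) (mE : measurable E) (PE0 : P E != 0).

Lemma conditional_probabilityE (A : set T) :
  conditional_probability mE A = cond_prob P E A.
Proof.
rewrite /conditional_probability/= /mnormalize/= /mrestr setTI ifF//.
by rewrite (negbTE PE0)/=; apply/negbTE; rewrite -ltey ltey_eq fin_num_measure.
Qed.

Let Pfin : P E \is a fin_num. Proof. exact: fin_num_measure. Qed.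

Lemma mul_conditional_probability (A : set T) :
  P E * conditional_probability mE A = P (A `&` E).
Proof.
rewrite conditional_probabilityE /cond_prob muleCA.
rewrite -[X in _ * (X * _)](fineK Pfin).
by rewrite -EFinM divff ?mule1// fine_eq0.
Qed.

(** Among the subsets of [E], the measure [P] is [P E] times the conditional
    probability, and the latter does not charge the complement of [E]. *)
Let ge0_integral_conditioning (f : T -> \bar R) :
  measurable_fun setT f -> (forall w, 0 <= f w) ->
  \int[P]_(w in E) f w = P E * \int[conditional_probability mE]_w f w.
Proof.
move=> mf f0.
have q0 : (0 <= fine (P E))%R by exact: fine_ge0.
rewrite (eq_measure_integral (mscale (NngNum q0) (conditional_probability mE))).
  rewrite ge0_integral_mscale//=; last exact: measurable_funTS.
  rewrite fineK//; congr (_ * _).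
  rewrite [RHS](ge0_negligible_integral (N := ~` E))//; last 2 first.
  - exact: measurableC.
  - apply: (etrans (conditional_probabilityE _)).
    by rewrite /cond_prob setICl measure0 mul0e.
  by rewrite setTD setCK.
move=> A mA AE; rewrite /= /mscale/= fineK//.
by rewrite [RHS]mul_conditional_probability setIidl.
Qed.

Lemma integral_conditioning (f : T -> \bar R) :
  (conditional_probability mE).-integrable setT f ->
  \int[P]_(w in E) f w = P E * \int[conditional_probability mE]_w f w.
Proof.
move=> intf; have mf := measurable_int _ intf.
rewrite integralE [in RHS]integralE.
rewrite !ge0_integral_conditioning//; last 2 first.
- exact: measurable_funeneg.
- exact: measurable_funepos.
rewrite [RHS]muleBr//.
by rewrite fin_num_adde_defr// integrable_fin_num//; exact: integrable_funepos.
Qed.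

End conditioning.

Section finite_partition.
Context d (T : measurableType d) (R : realType) (P : probability T R).
Context (I : finType) (Z : T -> I).
Hypothesis mZ : forall t, measurable (Z @^-1` [set t]).

Lemma integral_fibers (f : T -> R) : measurable_fun setT f ->
  \int[P]_w (f w)%:E = \sum_t \int[P]_(w in Z @^-1` [set t]) (f w)%:E.
Proof.
move=> mf.
have cover : \big[setU/set0]_(t : I) (Z @^-1` [set t]) = setT.
  apply/seteqP; split=> // w _; rewrite -bigcup_seq; exists (Z w) => //=.
  by rewrite mem_index_enum.
rewrite -integral_bigsetU_EFin ?cover//.
- by apply: index_enum_uniq.
- by move=> i j _ _ [w [/= -> ->]].
- exact/measurable_EFinP.
Qed.

Lemma measurable_preimage_fibers (A : set I) : measurable (Z @^-1` A).
Proof.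
have -> : Z @^-1` A = \big[setU/set0]_(t : I | t \in A) Z @^-1` [set t].
  apply/seteqP; split=> [w Aw|w]; rewrite -bigcup_seq_cond.
    by exists (Z w) => //=; rewrite mem_index_enum; exact: mem_set.
  by move=> [t /= /andP[_ /set_mem At] ->].
exact: bigsetU_measurable.
Qed.

Lemma integral_fun_fibers (g : I -> R) :
  \int[P]_w (g (Z w))%:E = \sum_t P (Z @^-1` [set t]) * (g t)%:E.
Proof.
have mg : measurable_fun setT (g \o Z).
  move=> _ A mA; rewrite setTI.
  exact: (measurable_preimage_fibers (g @^-1` A)).
rewrite (integral_fibers mg); apply: eq_bigr => t _.
rewrite (eq_integral (cst (g t)%:E)); first by rewrite integral_cst// muleC.
by move=> w; rewrite inE/= => ->.
Qed.

Lemma total_expectation (f : T -> R) :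
  (forall t, P (Z @^-1` [set t]) != 0) ->
  (forall t, (conditional_probability P (mZ t)).-integrable setT (EFin \o f)) ->
  measurable_fun setT f ->
  \int[P]_w (f w)%:E = \sum_t P (Z @^-1` [set t]) *
    \int[conditional_probability P (mZ t)]_w (f w)%:E.
Proof.
move=> P0 intf mf; rewrite (integral_fibers mf); apply: eq_bigr => t _.
by apply: integral_conditioning => //; exact: intf.
Qed.

End finite_partition.

(** * Selection bits and sub-samples *)

(** An inverse of [rev_prefix]: for k < n, the bit b_k is at index n - 1 - k. *)
Definition selected n (t : n.-tuple bool) (k : nat) : bool :=
  nth false t (n - k.+1).

Lemma rev_prefix_selected n (t : n.-tuple bool) : rev_prefix n (selected t) = t.
Proof.
apply: eq_from_tnth => i; rewrite tnth_mktuple /selected (tnth_nth false).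
by congr nth; have := ltn_ord i; lia.
Qed.

Lemma selected_rev_prefix n (b : nat -> bool) (k : nat) :
  (k < n)%N -> selected (rev_prefix n b) k = b k.
Proof.
move=> kn; have ln : (n - k.+1 < n)%N by lia.
rewrite /selected -(tnth_nth false _ (Ordinal ln)) tnth_mktuple /=.
by congr b; lia.
Qed.

Lemma measurable_tuple_set1 n (t : n.-tuple bool) : measurable [set t].
Proof.
have -> : [set t] = \big[setI/setT]_(i < n)
    ((fun u : n.-tuple bool => tnth u i) @^-1` [set tnth t i]).
  rewrite -bigcap_seq; apply/seteqP; split=> [_ -> //|u tu].
  by apply: eq_from_tnth => i; apply: tu; rewrite /= mem_index_enum.
apply: bigsetI_measurable => i _; rewrite -[X in measurable X]setTI.
exact: measurable_tnth.
Qed.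

(** The selection bit governing X_i: sub-sample j occupies the indices from
    2^(j-1) to 2^j - 1 and depends on the bit numbered j - 1. *)
Definition block (i : nat) : nat := trunc_log 2 i.

Lemma block_bounds (i : nat) : (0 < i)%N ->
  (2 ^ block i <= i < 2 ^ (block i).+1)%N.
Proof. by move=> i0; rewrite trunc_logP// trunc_log_ltn. Qed.

Lemma block_lt (n i : nat) : (0 < i < 2 ^ n)%N -> (block i < n)%N.
Proof.
move=> /andP[i0 ilt]; have /andP[lei _] := block_bounds i0.
by rewrite -(ltn_exp2l (m := 2))// (leq_ltn_trans lei).
Qed.

(** * The sample under the conditional probabilities *)

Section exponential_sampling.
Context (R : realType) (p : R) (H0 H1 : probability R R) (v0 v1 : R).
Hypotheses (p0 : (0 <= p)%R) (p1 : (p <= 1)%R).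
Hypotheses (hmu0 : 'E_H0[(fun x : R => x)] = 0%:E)
           (hmu1 : 'E_H1[(fun x : R => x)] = 1%:E)
           (hv0 : 'V_H0[(fun x : R => x)] = v0%:E)
           (hv1 : 'V_H1[(fun x : R => x)] = v1%:E).
Context (d : measure_display) (T : measurableType d) (P : probability T R).
Context (B : nat -> {RV P >-> bool}) (X : nat -> {RV P >-> R}).
Hypothesis hBX : exponential_sampling p H0 H1 B X.
Context (n : nat) (n0 : (1 <= n)%N).

Local Notation Z := (selection_vector B n).
Local Notation N := (2 ^+ n - 1 : R)%R.

Lemma measurable_selection_vector (t : n.-tuple bool) :
  measurable (Z @^-1` [set t]).
Proof.
have mZ : measurable_fun setT (Z : T -> n.-tuple bool).
  apply/measurable_fun_tnthP => i; rewrite (_ : _ \o _ = B (n - i.+1)%N)//.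
  by apply/funext => w /=; rewrite tnth_mktuple.
rewrite -[X in measurable X]setTI.
by apply: mZ => //; exact: measurable_tuple_set1.
Qed.

Local Notation mZ := measurable_selection_vector.
Local Notation Q t := (conditional_probability P (mZ t)).
Local Notation H t i := (if selected t (block i) then H1 else H0).

Lemma cond_law_selection (t : n.-tuple bool) (i : nat) (A : set R) :
  (1 <= i < 2 ^ n)%N -> measurable A ->
  cond_prob P (Z @^-1` [set t]) (X i @^-1` A) = H t i A.
Proof.
move=> iN mA; have /andP[i0 _] := iN.
have := @sample_cond_law _ _ _ _ _ _ _ _ _ hBX n (selected t) (block i).+1 i.
rewrite rev_prefix_selected /=.
by apply=> //; [exact: block_lt | exact: block_bounds].
Qed.

(** Conditionally on [Z = t] the variable X_1 has a genuine probability
    distribution, whereas the elementary conditional probability given a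
    negligible event vanishes identically. *)
Lemma selection_prob_neq0 (t : n.-tuple bool) : P (Z @^-1` [set t]) != 0.
Proof.
apply/eqP => Pt0.
have : cond_prob P (Z @^-1` [set t]) (X 1 @^-1` setT) = H t 1 setT.
  by apply: cond_law_selection => //; rewrite -[1%N](expn0 2) ltn_exp2l.
rewrite probability_setT /cond_prob preimage_setT setTI Pt0 mul0e.
by move=> /esym/eqP; rewrite onee_eq0.
Qed.

Local Notation Pt0 := selection_prob_neq0.

Lemma cond_moments (t : n.-tuple bool) (i : nat) : (1 <= i < 2 ^ n)%N ->
  [/\ (X i : T -> R) \in Lfun (Q t) 2%:E,
      'E_(Q t)[X i] = (selected t (block i))%:R%:E &
      'V_(Q t)[X i] = (if selected t (block i) then v1 else v0)%:E].
Proof.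
move=> iN; apply: (moments_of_law (H := H t i)).
- move=> A mA; rewrite [LHS]conditional_probabilityE; last exact: Pt0.
  exact: cond_law_selection.
- by case: ifP.
- by case: ifP.
Qed.

Lemma cond_uncorrelated (t : n.-tuple bool) (i k : nat) :
  (1 <= i < 2 ^ n)%N -> (1 <= k < 2 ^ n)%N -> i != k ->
  covariance (Q t) (X i) (X k) = 0.
Proof.
move=> iN kN ik.
have [Xi2 _ _] := cond_moments t iN; have [Xk2 _ _] := cond_moments t kN.
apply: independent_covariance0 => // A C mA mC.
have PE0 := Pt0 t; rewrite !(conditional_probabilityE (mZ t) PE0).
pose F l := if l == i then A else C.
have iF : F i = A by rewrite /F eqxx.
have kF : F k = C by rewrite /F eq_sym (negbTE ik).
have ik_uniq : uniq [:: i; k] by rewrite /= inE ik.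
have ikN : [set` [:: i; k]] `<=` [set l | (1 <= l < 2 ^ n)%N].
  by move=> l /=; rewrite !inE => /orP[] /eqP ->.
have mF l : measurable (F l) by rewrite /F; case: ifP.
have := sample_cond_independent hBX (selected t) ik_uniq ikN mF.
by rewrite rev_prefix_selected bigcap_seq !big_cons !big_nil setIT mule1 iF kF.
Qed.

Definition cond_mean (t : n.-tuple bool) : R :=
  ((\sum_(1 <= i < 2 ^ n) (selected t (block i))%:R) / N)%R.

Definition cond_var (t : n.-tuple bool) : R :=
  ((\sum_(1 <= i < 2 ^ n) (if selected t (block i) then v1 else v0))
     / N ^+ 2)%R.

Lemma sample_meanE :
  sample_mean X n = (N^-1 \o* \sum_(1 <= i < 2 ^ n) (X i : T -> R))%R.
Proof.
by apply/funext => w; rewrite /sample_mean /sample_sum /= fct_sumE.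
Qed.

Lemma sample_mean_cond_moments (t : n.-tuple bool) :
  [/\ sample_mean X n \in Lfun (Q t) 2%:E,
      'E_(Q t)[sample_mean X n] = (cond_mean t)%:E &
      'V_(Q t)[sample_mean X n] = (cond_var t)%:E].
Proof.
have Qfin : Q t setT \is a fin_num := fin_num_measure _ _ measurableT.
have iN i : i \in index_iota 1 (2 ^ n) -> (1 <= i < 2 ^ n)%N.
  by rewrite mem_index_iota.
have X2 i : i \in index_iota 1 (2 ^ n) -> (X i : T -> R) \in Lfun (Q t) 2%:E.
  by move=> /iN/(cond_moments t)[].
have S2 : (\sum_(1 <= i < 2 ^ n) (X i : T -> R))%R \in Lfun (Q t) 2%:E.
  by rewrite big_seq rpred_sum ?lee1n// => ? i; exact: X2.
rewrite sample_meanE; split.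
- by apply: Lfun_scale => //; rewrite ler1n.
- rewrite expectationZl; last exact: (Lfun_subset12 Qfin).
  rewrite -(big_map (fun i => X i : T -> R) xpredT idfun).
  rewrite expectation_sum; last first.
    by move=> _ /mapP[i iI ->]; apply: (Lfun_subset12 Qfin); exact: X2.
  rewrite big_map big_seq.
  under eq_bigr => i /iN/(cond_moments t)[_ -> _] do [].
  by rewrite -big_seq sumEFin -EFinM mulrC.
- rewrite varianceZ// variance_sum_uncorrelated ?iota_uniq//; last first.
    by move=> i k /iN iI /iN kI ik; exact: cond_uncorrelated.
  rewrite big_seq.
  under eq_bigr => i /iN/(cond_moments t)[_ _ ->] do [].
  by rewrite -big_seq sumEFin -EFinM exprVn mulrC.
Qed.

(** Both sides compute the expectation of g(B_k), over the fibers of the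
    selection vector and over the fibers of [B k]. *)
Lemma selection_average (g : bool -> R) (k : nat) : (k < n)%N ->
  \sum_t P (Z @^-1` [set t]) * (g (selected t k))%:E =
  (p * g true + (1 - p) * g false)%:E.
Proof.
move=> kn; rewrite -(integral_fun_fibers P mZ (fun t => g (selected t k))).
rewrite (eq_integral (fun w => (g (B k w))%:E)); last first.
  by move=> w _; rewrite selected_rev_prefix.
have mB b : measurable (B k @^-1` [set b]).
  by rewrite -[X in measurable X]setTI; exact: measurable_funP.
rewrite (integral_fun_fibers P mB) big_bool/=.
have PB b : P (B k @^-1` [set b]) = bernoulli_prob p [set b].
  exact: (selection_bernoulli hBX).
rewrite !PB !bernoulli_probE ?p0// !diracE !in_set1/=.
by rewrite !(mule1, mule0, adde0, add0e).
Qed.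

(** After exchanging the sums, each of the [N] variables contributes the
    expectation of [g] at its own selection bit. The conditional means and the
    conditional variances of the variables are both functions of that bit. *)
Lemma block_average (g : bool -> R) :
  (\sum_t fine (P (Z @^-1` [set t])) *
    \sum_(1 <= i < 2 ^ n) g (selected t (block i)) =
  N * (p * g true + (1 - p) * g false))%R.
Proof.
have avg i : (1 <= i < 2 ^ n)%N ->
    (\sum_t fine (P (Z @^-1` [set t])) * g (selected t (block i)) =
     p * g true + (1 - p) * g false)%R.
  move=> iN; apply/EFin_inj.
  rewrite -(selection_average g (block_lt iN)) -sumEFin.
  by apply: eq_bigr => t _; rewrite EFinM fineK// fin_num_measure//; exact: mZ.
under eq_bigr do rewrite big_distrr/=.
rewrite exchange_big/= big_nat.
rewrite (eq_bigr (fun=> p * g true + (1 - p) * g false)%R); last first.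
  by move=> i /avg.
rewrite -big_nat sumr_const_nat -[LHS]mulr_natl natrB ?expn_gt0//.
by rewrite natrX.
Qed.

Lemma sample_size_gt0 : (0 < N)%R.
Proof. by rewrite subr_gt0 exprn_egt1// ?ltr1n// -lt0n. Qed.

Lemma expectation_cond_mean :
  (\sum_t fine (P (Z @^-1` [set t])) * cond_mean t = p)%R.
Proof.
under eq_bigr do rewrite mulrA.
rewrite -mulr_suml (block_average (fun b => b%:R)).
by rewrite mulr1 mulr0 addr0 mulrAC mulfV ?mul1r// gt_eqF// sample_size_gt0.
Qed.

Lemma expectation_cond_var :
  (\sum_t fine (P (Z @^-1` [set t])) * cond_var t =
   (p * v1 + (1 - p) * v0) / N)%R.
Proof.
under eq_bigr do rewrite mulrA.
rewrite -mulr_suml (block_average (fun b => if b then v1 else v0)).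
have := sample_size_gt0; move: N => M M0; field.
by rewrite gt_eqF.
Qed.

Lemma measurable_sample_mean : measurable_fun setT (sample_mean X n).
Proof.
by apply: measurable_funM => //; apply: measurable_sum.
Qed.

Lemma expectation_sample_mean : 'E_P[sample_mean X n] = p%:E.
Proof.
have mX := measurable_sample_mean.
rewrite unlock (total_expectation (mZ := mZ) selection_prob_neq0)//; last first.
  move=> t; have [X2 _ _] := sample_mean_cond_moments t.
  apply/Lfun1_integrable; apply: Lfun_subset12 X2.
  exact: fin_num_measure _ _ measurableT.
rewrite -[in RHS]expectation_cond_mean -sumEFin; apply: eq_bigr => t _.
have [_ + _] := sample_mean_cond_moments t; rewrite unlock => ->.
by rewrite [RHS]EFinM fineK// fin_num_measure//; exact: mZ.
Qed.

(** Being measurable for the sigma-algebra generated by [Z], the function [Y]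
    is constant on each fiber of [Z]; its value there is the conditional mean
    because the fiber is not negligible. The equality holds at every point, not
    only almost everywhere. *)
Lemma cond_expectation_eq_cond_mean (Y : T -> R) :
  is_cond_expectation P Z (sample_mean X n) Y -> Y =1 cond_mean \o Z.
Proof.
move=> [mY intY YX] w /=; set t := Z w.
have YE : {in Z @^-1` [set t], forall w', Y w' = Y w}.
  move=> w' /set_mem /= w't.
  have [C mC ZC] := mY measurableT _ (measurable_set1 (Y w)).
  have : (setT `&` Y @^-1` [set Y w]) w by [].
  rewrite -ZC => -[_ /= Cw].
  have : (setT `&` Z @^-1` C) w' by split=> //=; rewrite w't.
  by rewrite ZC => -[].
have : \int[P]_(w in Z @^-1` [set t]) (Y w)%:E =
       \int[P]_(w in Z @^-1` [set t]) (sample_mean X n w)%:E.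
  apply: YX; exists [set t]; first exact: measurable_tuple_set1.
  by rewrite setTI.
rewrite (eq_integral (cst (Y w)%:E)); last by move=> w' /YE ->.
have [X2 EX _] := sample_mean_cond_moments t.
rewrite integral_cst; last exact: mZ.
rewrite (integral_conditioning (mE := mZ t)); last 2 first.
- exact: selection_prob_neq0.
- apply/Lfun1_integrable; apply: Lfun_subset12 X2.
  exact: fin_num_measure _ _ measurableT.
rewrite muleC; move: EX; rewrite unlock => -> PY.
have Pfin : P (Z @^-1` [set t]) \is a fin_num.
  by rewrite fin_num_measure//; exact: mZ.
have P0 : fine (P (Z @^-1` [set t])) != 0%R.
  by rewrite fine_eq0 ?Pfin //; exact: selection_prob_neq0.
apply: (mulfI P0); apply: EFin_inj.
by rewrite [LHS]EFinM [RHS]EFinM fineK.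
Qed.

(** The law of total variance: on the fiber of [t], the second moment of the
    sample mean about [p] is its conditional variance plus the square of the
    deviation of its conditional mean from [p]. *)
Lemma variance_sample_mean (Y : T -> R) :
  is_cond_expectation P Z (sample_mean X n) Y ->
  'V_P[sample_mean X n] = 'V_P[Y] + ((p * v1 + (1 - p) * v0) / N)%:E.
Proof.
move=> /cond_expectation_eq_cond_mean/funext ->.
have Pfin t : P (Z @^-1` [set t]) \is a fin_num.
  by rewrite fin_num_measure//; exact: mZ.
have EY : 'E_P[cond_mean \o Z] = p%:E.
  rewrite unlock (integral_fun_fibers P mZ) -expectation_cond_mean -sumEFin.
  by apply: eq_bigr => t _; rewrite [RHS]EFinM fineK.
rewrite (variance_sqr expectation_sample_mean) (variance_sqr EY).
rewrite (integral_fun_fibers P mZ (fun t => (cond_mean t - p) ^+ 2)%R).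
rewrite -expectation_cond_var -sumEFin -big_split/=.
have mX := measurable_sample_mean.
rewrite (total_expectation (mZ := mZ) selection_prob_neq0); first last.
- by apply: measurable_funX; exact: measurable_funB.
- move=> t; have [X2 _ _] := sample_mean_cond_moments t.
  apply: (@Lfun2_integrable_sqr _ _ _ _ (sample_mean X n \- cst p)%R).
  by rewrite rpredB ?lee1n// => ?; exact: Lfun_cst.
apply: eq_bigr => t _.
have [X2 EX VX] := sample_mean_cond_moments t.
rewrite (integral_sqr_shift p X2 EX VX) -[P _](fineK (Pfin t)).
by rewrite -!EFinM -EFinD; congr _%:E; ring.
Qed.

End exponential_sampling.

Theorem theorem12 (R : realType) (p : R) (hp0 : (0 < p)%R) (hp1 : (p < 1)%R)
    (H0 H1 : probability R R) (sigma0 sigma1 : R)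
    (hmu0 : 'E_H0[(fun x : R => x)] = 0)
    (hmu1 : 'E_H1[(fun x : R => x)] = 1)
    (hsigma0 : 'V_H0[(fun x : R => x)] = (sigma0 ^+ 2)%:E)
    (hsigma1 : 'V_H1[(fun x : R => x)] = (sigma1 ^+ 2)%:E)
    (d : measure_display) (T : measurableType d) (P : probability T R)
    (B : nat -> {RV P >-> bool}) (X : nat -> {RV P >-> R})
    (hBX : exponential_sampling p H0 H1 B X)
    (n : nat) (hn : (1 <= n)%N) :
  'E_P[sample_mean X n] = p%:E /\
  (forall Y : T -> R,
     is_cond_expectation P (selection_vector B n) (sample_mean X n) Y ->
     'V_P[sample_mean X n] =
       'V_P[Y] +
       ((p * sigma1 ^+ 2 + (1 - p) * sigma0 ^+ 2) / (2 ^+ n - 1))%:E).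
Proof.
have p0 := ltW hp0; have p1 := ltW hp1; split.
  exact: (expectation_sample_mean p0 p1 hmu0 hmu1 hsigma0 hsigma1 hBX hn).
move=> Y; exact: (variance_sample_mean p0 p1 hmu0 hmu1 hsigma0 hsigma1 hBX hn).
Qed.
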